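(* Let $k\ge1$, let $v_1,\dots,v_k\in\mathcal{H}$ with $\mathcal{V}_k=\operatorname{span}\{v_i\}_{i=1}^k$ satisfying $\mathcal{V}_k\cap\mathcal{W}^\perp=\{0\}$, and let $u_i=v_i-\hat P_{\mathcal{W}^\perp}v_i$, $i=1,\dots,k$. Let the oblique projector onto $\mathcal{V}_k$ along $\mathcal{W}^\perp$ be given by $$\hat E_{\mathcal{V}_k\mathcal{W}^\perp}=\sum_{i=1}^k v_i\langle\tilde u_i^k,\cdot\rangle$$ with dual vectors $\tilde u_1^k,\dots,\tilde u_k^k\in\mathcal{H}$. Assume that removing the vector $v_j$ (for some $j\in\{1,\dots,k\}$) from the spanning set of $\mathcal{V}_k$ leaves the identical subspace, i.e. $v_j\in\mathcal{V}_{k\setminus j}:=\operatorname{span}\{v_i: 1\le i\le k,\ i\ne j\}$. If the remaining dual vectors are modified as $$\tilde u_i^{k\setminus j}=\tilde u_i^k+\frac{\langle u_j,\tilde u_i^k\rangle\,\tilde u_j^k}{1-\langle u_j,\tilde u_j^k\rangle},\qquad i\in\{1,\dots,k\}\setminus\{j\},$$ then the corresponding oblique projector does not change, i.e. the operator $\hat E_{\mathcal{V}_{k\setminus j}\mathcal{W}^\perp}=\sum_{i=1,\,i\ne j}^{k}v_i\langle\tilde u_i^{k\setminus j},\cdot\rangle$ satisfies $$\hat E_{\mathcal{V}_{k\setminus j}\mathcal{W}^\perp}=\hat E_{\mathcal{V}_k\mathcal{W}^\perp}.$$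
   Context: $\mathcal{H}$ is a complex inner product space; $\langle\cdot,\cdot\rangle$ is conjugate-linear in the first argument and linear in the second, and $v\langle u,\cdot\rangle$ denotes the operator $f\mapsto\langle u,f\rangle v$. $\mathcal{W}^\perp\subset\mathcal{H}$ is a fixed closed subspace (the symbol is just its name), and $\hat P_{\mathcal{W}^\perp}$ is the orthogonal projector of $\mathcal{H}$ onto it. For a finite-dimensional subspace $\mathcal{X}=\operatorname{span}\{x_i\}_{i=1}^m\subset\mathcal{H}$ with $\mathcal{X}\cap\mathcal{W}^\perp=\{0\}$, the oblique projector $\hat E_{\mathcal{X}\mathcal{W}^\perp}$ onto $\mathcal{X}$ along $\mathcal{W}^\perp$ is the idempotent linear operator with $\hat E_{\mathcal{X}\mathcal{W}^\perp}x=x$ for $x\in\mathcal{X}$ and $\hat E_{\mathcal{X}\mathcal{W}^\perp}w=0$ for $w\in\mathcal{W}^\perp$, given by $\hat X(\hat X^*\hat P\hat X)^\dagger\hat X^*\hat P$. Here $\hat X:\mathbb{C}^m\to\mathcal{H}$ sends the $i$-th standard basis vector to $x_i$, $\hat P$ is the orthogonal projector onto the orthogonal complement of $\mathcal{W}^\perp$ in $\mathcal{X}+\mathcal{W}^\perp$, and $\dagger$ is the Moore-Penrose pseudo-inverse. When the $v_i$ are linearly dependent, the dual vectors $\tilde u_i^k$ representing $\hat E_{\mathcal{V}_k\mathcal{W}^\perp}$ are not unique.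
   Formalization: The formal theorem additionally assumes that the denominator 1 − ⟨u_j, ũ_j^k⟩ is nonzero; for arbitrary dual vectors of a dependent family it can vanish (e.g. v_1 = v_2, duals 0 and u/‖u‖², j = 2), and then the modified dual vectors are undefined. *)

(* Defs.v *)
From HB Require Import structures.
From mathcomp Require Import all_boot all_order all_algebra.
From mathcomp Require Import sesquilinear spectral complex.
From mathcomp Require Import boolp classical_sets reals topology normedtype.

Set Implicit Arguments.
Unset Strict Implicit.
Unset Printing Implicit Defensive.

Import Order.TTheory GRing.Theory Num.Theory.
Local Open Scope classical_set_scope.
Local Open Scope sesquilinear_scope.
Local Open Scope ring_scope.
Local Open Scope complex_scope.

(* [{dot H for conjC}] is linear in its first argument and conjugate-linear in
   the second; [inner] uses the opposite convention, so that
   [fun f => inner dot u f *: v] is the linear operator v <u, .>. *)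
Definition inner (R : realType) (H : lmodType R[i])
    (dot : {dot H for (@Num.conj R[i])}) (u f : H) : R[i] := dot f u.

(* The span of the subfamily {v i : P i}. *)
Definition lspan (R : realType) (H : lmodType R[i]) (I : finType)
    (P : pred I) (v : I -> H) : set H :=
  [set f | exists c : I -> R[i], f = \sum_(i | P i) c i *: v i].

Definition linear_subspace (R : realType) (H : lmodType R[i]) (W : set H) : Prop :=
  W 0 /\ forall (a : R[i]) (f g : H), W f -> W g -> W (a *: f + g).

Definition orthocompl_in (R : realType) (H : lmodType R[i])
    (dot : {dot H for (@Num.conj R[i])}) (S W : set H) : set H :=
  [set f | S f /\ forall w : H, W w -> inner dot w f = 0].

(* Orthogonal decomposition form: P f lies in S and f - P f is orthogonal to S;
   this determines P f uniquely. *)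
Definition orthogonal_projector (R : realType) (H : lmodType R[i])
    (dot : {dot H for (@Num.conj R[i])}) (S : set H) (P : H -> H) : Prop :=
  forall f : H, S (P f) /\ forall s : H, S s -> inner dot s (f - P f) = 0.

(* The four Penrose equations; they determine B uniquely. *)
Definition moore_penrose (C : numClosedFieldType) (m n : nat)
    (A : 'M[C]_(m, n)) (B : 'M[C]_(n, m)) : Prop :=
  [/\ A *m B *m A = A, B *m A *m B = B,
      (A *m B) ^t* = A *m B & (B *m A) ^t* = B *m A].

(* The operator C^m -> H sending the i-th basis vector to x i. *)
Definition synthesis (R : realType) (H : lmodType R[i]) (m : nat)
    (x : 'I_m -> H) (c : 'cV[R[i]]_m) : H := \sum_i c i 0 *: x i.

(* The adjoint of [synthesis x]. *)
Definition analysis (R : realType) (H : lmodType R[i])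
    (dot : {dot H for (@Num.conj R[i])}) (m : nat)
    (x : 'I_m -> H) (f : H) : 'cV[R[i]]_m := \col_i inner dot (x i) f.

(* E is the oblique projector onto X along W.  When X + W is not the whole
   space, the first four clauses do not fix E; the last one, E = X (X^* P X)^+
   X^* P for a spanning family of X, does (it makes E vanish on the orthogonal
   complement of X + W), and E does not depend on the family chosen. *)
Definition oblique_projector (R : realType) (H : lmodType R[i])
    (dot : {dot H for (@Num.conj R[i])}) (X W : set H) (E : H -> H) : Prop :=
  [/\ linear E,
      forall f : H, E (E f) = E f,
      forall x : H, X x -> E x = x,
      forall w : H, W w -> E w = 0 &
      exists (m : nat) (x : 'I_m -> H) (P : H -> H) (B : 'M[R[i]]_m),
        [/\ X = lspan predT x,
            orthogonal_projector dot
              (orthocompl_in dot [set a + w | a in X & w in W] W) P,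
            moore_penrose (\matrix_(i, j) inner dot (x i) (P (x j))) B &
            forall f : H, E f = synthesis x (B *m analysis dot x (P f))]].

(* Main.v *)
(* Since u_j differs from v_j by an element of W, E u_j = v_j.  Expanding the
   modified duals, E' f equals E f - <ud_j, f> v_j plus
   <ud_j, f> / (1 - <ud_j, u_j>) times E u_j - <ud_j, u_j> v_j, which is
   (1 - <ud_j, u_j>) v_j, so the corrections cancel. *)
Require Import Defs.
From mathcomp Require Import all_boot all_order all_algebra.
From mathcomp Require Import sesquilinear complex.
From mathcomp Require Import boolp classical_sets reals topology normedtype.

Set Implicit Arguments.
Unset Strict Implicit.
Unset Printing Implicit Defensive.

Import Order.TTheory GRing.Theory Num.Theory.
Local Open Scope classical_set_scope.
Local Open Scope ring_scope.
Local Open Scope complex_scope.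

Lemma lspan_redundant (R : realType) (H : lmodType R[i]) (I : finType)
    (v : I -> H) (j : I) :
  lspan [pred i | i != j] v (v j) ->
  lspan predT v = lspan [pred i | i != j] v.
Proof.
case=> c vjE; apply/seteqP; split=> f [a ->].
  (* Substituting the expansion of [v j] spreads its coefficient [a j] over the other vectors; the
     value at [j] itself is never summed. *)
  exists (fun i => a i + a j * c i).
  rewrite (bigD1 j) //= vjE scaler_sumr -big_split /=.
  by apply: eq_bigr => i _; rewrite scalerA -scalerDl addrC.
exists (fun i => if i == j then 0 else a i).
rewrite [RHS](bigD1 j) //= eqxx scale0r add0r.
by apply: eq_bigr => i /negPf ->.
Qed.

Lemma inner_conj (R : realType) (H : lmodType R[i])
    (dot : {dot H for (@Num.conj R[i])}) (f g : H) :
  Num.conj (inner dot f g) = inner dot g f.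
Proof. by rewrite /inner [dot f g]hermC expr0 mul1r. Qed.

(** The scalar comes out conjugated because [inner] is conjugate-linear in its first slot, which is
    where the modified duals stand. *)
Lemma innerDZl (R : realType) (H : lmodType R[i])
    (dot : {dot H for (@Num.conj R[i])}) (a : R[i]) (x y f : H) :
  inner dot (x + a *: y) f = inner dot x f + Num.conj a * inner dot y f.
Proof. by rewrite /inner linearDr linearZr. Qed.

Theorem proposition3 (R : realType) (H : normedModType R[i])
    (dot : {dot H for (@Num.conj R[i])})
    (norm_dot : forall f : H, `|f| = sqrtC (inner dot f f))
    (W : set H) (subW : linear_subspace W) (closedW : closed W)
    (PW : H -> H) (PW_proj : orthogonal_projector dot W PW)
    (k : nat) (k_ge1 : (1 <= k)%N) (v : 'I_k -> H)
    (VW0 : lspan predT v `&` W = [set 0])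
    (u : 'I_k -> H) (uE : forall i : 'I_k, u i = v i - PW (v i))
    (E : H -> H) (E_proj : oblique_projector dot (lspan predT v) W E)
    (ud : 'I_k -> H)
    (E_sum : forall f : H, E f = \sum_(i < k) inner dot (ud i) f *: v i)
    (j : 'I_k) (vj_redundant : lspan [pred i | i != j] v (v j))
    (denom_neq0 : 1 - inner dot (u j) (ud j) != 0)
    (ud' : 'I_k -> H)
    (ud'E : forall i : 'I_k, i != j ->
       ud' i = ud i + (inner dot (u j) (ud i) / (1 - inner dot (u j) (ud j)))
                        *: ud j) :
  let E' := fun f : H => \sum_(i < k | i != j) inner dot (ud' i) f *: v i in
  oblique_projector dot (lspan [pred i | i != j] v) W E' /\
  (forall f : H, E' f = E f).
Proof.
(* Pointwise equality suffices: the two spans are the same set, so the projector property of [E]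
   carries over to [E'] by extensionality. *)
move=> E'; suff E'E f : E' f = E f.
  by split=> //; rewrite -lspan_redundant // (funext E'E).
have [_ _ EV EW _] := E_proj.
have [PWvj _] := PW_proj (v j).
have Vvj : lspan predT v (v j) by rewrite (lspan_redundant vj_redundant).
(* Needed twice, at [g = f] and at [g = u j]. *)
have sumV g : \sum_(i | i != j) inner dot (ud i) g *: v i
    = E g - inner dot (ud j) g *: v j.
  by rewrite E_sum [in RHS](bigD1 j) //= addrAC subrr add0r.
have Euj : E (u j) = v j.
  have [linE _ _ _ _] := E_proj.
  by rewrite uE addrC -scaleN1r linE EW // EV // scaler0 add0r.
(* Conjugation turns the denominator of the modified duals into the factor left on [v j] by [sumV]
   at [u j]. *)
have denomC : Num.conj (1 - inner dot (u j) (ud j)) = 1 - inner dot (ud j) (u j).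
  by rewrite rmorphB rmorph1 /= inner_conj.
have denomC_neq0 : 1 - inner dot (ud j) (u j) != 0 by rewrite -denomC conjC_eq0.
(* The correction to the [i]-th coefficient is [b * inner dot (ud i) (u j)]; since [b] is
   independent of [i], it factors out of the sum. *)
pose b := inner dot (ud j) f / (1 - inner dot (ud j) (u j)).
have -> : E' f = \sum_(i | i != j) inner dot (ud i) f *: v i
    + b *: \sum_(i | i != j) inner dot (ud i) (u j) *: v i.
  rewrite scaler_sumr -big_split; apply: eq_bigr => i ij /=.
  rewrite ud'E // innerDZl rmorphM fmorphV /= denomC inner_conj scalerDl scalerA.
  by congr (_ + _ *: _); rewrite mulrAC [RHS]mulrAC (mulrC (inner dot (ud j) f)).
(* Multiplying [b] by its own denominator leaves [inner dot (ud j) f], exactly the coefficient of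
   [v j] removed from [E f]. *)
rewrite !sumV Euj -{2}[v j]scale1r -scalerBl scalerA divfK //.
exact: subrK.
Qed.
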